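(* Let $\mathcal X$ be finite, $P_0,P_1$ distributions on $\mathcal X$ with full support, and $\gamma$ with $-D(P_0\|P_1)\le\gamma\le D(P_1\|P_0)$. Let $Q_\lambda(x)=P_0^{1-\lambda}(x)P_1^{\lambda}(x)/\sum_aP_0^{1-\lambda}(a)P_1^{\lambda}(a)$ with $\lambda\in[0,1]$ solving $D(Q_\lambda\|P_0)-D(Q_\lambda\|P_1)=\gamma$, and let $E_0=D(Q_\lambda\|P_0)$, $E_1=D(Q_\lambda\|P_1)$. Let $\mathcal Q_0^{\rm adv}=\{\hat Q\in\mathcal P(\mathcal X):D(\hat Q\|P_0)-D(\hat Q\|P_1)\ge\gamma\}$, $\mathcal Q_1^{\rm adv}=\{\hat Q\in\mathcal P(\mathcal X):D(\hat Q\|P_0)-D(\hat Q\|P_1)\le\gamma\}$, and for $r\ge0$ $$\underline{\hat E}_0(r)=\min_{\substack{\hat Q\in\mathcal Q_0^{\rm adv}\\ Q:\,d(Q,\hat Q)\le r}}D(Q\|P_0),\qquad \underline{\hat E}_1(r)=\min_{\substack{\hat Q\in\mathcal Q_1^{\rm adv}\\ Q:\,d(Q,\hat Q)\le r}}D(Q\|P_1).$$ Then for $i\in\{0,1\}$, as $r\to0$, $$\underline{\hat E}_i(r)=E_i-\sqrt{r\,\theta_i(P_0,P_1,\gamma)}+o(\sqrt r),\qquad \theta_i(P_0,P_1,\gamma)=\frac2\alpha\mathrm{Var}_{Q_\lambda}\Big(\log\frac{Q_\lambda(X)}{P_i(X)}\Big).$$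
   Context: $D$ is relative entropy. Setting: the likelihood ratio test with correct distributions $P_0,P_1$ and threshold $\gamma$ (decide 1 iff $D(\hat T\|P_0)-D(\hat T\|P_1)\ge\gamma$) is applied to a tampered observation whose type $\hat Q$ is within distance $r$ of the true observation type $Q$; $\underline{\hat E}_i(r)$ are the resulting worst-case error exponents. The distance $d$ is either the Rényi divergence $d(Q,\hat Q)=D_\alpha(Q\|\hat Q)=\frac{1}{\alpha-1}\log\sum_xQ(x)^\alpha\hat Q(x)^{1-\alpha}$ of order $\alpha>0$ ($\alpha=1$: relative entropy), or an $f$-divergence $d(Q,\hat Q)=\sum_x\hat Q(x)f(Q(x)/\hat Q(x))$ with $f$ convex, twice differentiable, and $\alpha:=f''(1)$. *)

(* Defs.v *)
From HB Require Import structures.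
From mathcomp Require Import all_boot all_order all_algebra.
From mathcomp Require Import all_classical all_reals all_analysis.
Set Implicit Arguments. Unset Strict Implicit. Unset Printing Implicit Defensive.
Import Order.TTheory GRing.Theory Num.Theory.
Import numFieldNormedType.Exports.
Local Open Scope classical_set_scope.
Local Open Scope ring_scope.

Section Defs.
Variables (R : realType) (X : finType).

Definition is_pmf (Q : X -> R) : Prop :=
  (forall x, 0 <= Q x) /\ \sum_(x : X) Q x = 1.

Definition full_support (P : X -> R) : Prop := forall x, 0 < P x.

(* relative entropy D(Q||P) (natural log), for P with full support;
   convention 0 log 0 = 0 holds since 0 * _ = 0 *)
Definition KL (Q P : X -> R) : R := \sum_(x : X) Q x * ln (Q x / P x).

Definition renyi_div (alpha : R) (Q Qh : X -> R) : \bar R :=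
  if alpha == 1 then
    (if `[< exists x, 0 < Q x /\ Qh x = 0 >] then +oo%E
     else (\sum_(x : X) Q x * ln (Q x / Qh x))%:E)
  else if (1 < alpha) && `[< exists x, 0 < Q x /\ Qh x = 0 >] then +oo%E
  else
    let s := \sum_(x : X) (Q x `^ alpha) * (Qh x `^ (1 - alpha)) in
    if s == 0 then +oo%E else ((alpha - 1)^-1 * ln s)%:E.

(* f(0) := lim_{t -> 0+} f(t) in (-oo, +oo] for f convex on ]0,+oo[
   (computed as a sup of chord extrapolations, which is the limit) *)
Definition f_at0 (f : R -> R) : \bar R :=
  ereal_sup [set (f 1 - (f 1 - f t) / (1 - t))%:E | t in `]0, 1[ ].

(* f'(oo) := lim_{t -> oo} f(t)/t in (-oo, +oo] for f convex on ]0,+oo[ *)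
Definition f_atinf (f : R -> R) : \bar R :=
  ereal_sup [set ((f t - f 1) / (t - 1))%:E | t in `]1, +oo[ ].

(* f-divergence D_f(Q || Qh) = sum_x Qh(x) f(Q(x)/Qh(x)), with the standard
   conventions 0 f(0/0) = 0, Qh f(0/Qh) = Qh f(0), 0 f(a/0) = a f'(oo). *)
Definition f_div (f : R -> R) (Q Qh : X -> R) : \bar R :=
  (\sum_(x : X)
     (if (0 < Qh x)%R then
        (if (0 < Q x)%R then (Qh x * f (Q x / Qh x))%:E else (Qh x)%:E * f_at0 f)
      else if (0 < Q x)%R then (Q x)%:E * f_atinf f else 0))%E.

Definition admissible_distance (d : (X -> R) -> (X -> R) -> \bar R) (alpha : R)
  : Prop :=
  (0 < alpha /\ d = renyi_div alpha) \/
  (exists f : R -> R,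
     (forall x y t, 0 < x -> 0 < y -> 0 <= t <= 1 ->
        f (t * x + (1 - t) * y) <= t * f x + (1 - t) * f y) /\
     (forall x, 0 < x -> derivable f x 1) /\
     (forall x, 0 < x -> derivable (derive1 f) x 1) /\
     f 1 = 0 /\
     alpha = derive1 (derive1 f) 1 /\ 0 < alpha /\
     d = f_div f).

Definition tilt (P0 P1 : X -> R) (lam : R) (x : X) : R :=
  (P0 x `^ (1 - lam)) * (P1 x `^ lam) /
  \sum_(a : X) (P0 a `^ (1 - lam)) * (P1 a `^ lam).

Definition var_under (Q g : X -> R) : R :=
  \sum_(x : X) Q x * g x ^+ 2 - (\sum_(x : X) Q x * g x) ^+ 2.

(* worst-case error exponent \underline{\hat E}_i(r); i = false is 0, true is 1.
   The minimum of the paper is written as an infimum (it is attained). *)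
Definition Ehat (d : (X -> R) -> (X -> R) -> \bar R) (P0 P1 : X -> R)
  (gamma : R) (i : bool) (r : R) : R :=
  inf [set KL Q (if i then P1 else P0) | Q in
        [set Q | is_pmf Q /\ exists Qh, is_pmf Qh /\
           (if i then KL Qh P0 - KL Qh P1 <= gamma
                 else gamma <= KL Qh P0 - KL Qh P1) /\
           (d Q Qh <= r%:E)%E ] ].

End Defs.

(* Main.v *)
(* A divergence of order alpha behaves like (alpha/2) chi2 near the diagonal, and
   small divergence forces Q and Qh to be uniformly close.  With
   L = log (P1/P0), W = Q_lambda and m = E_W L, one has for every Q
     D(Q||P0) = D(W||P0) + D(Q||W) + lambda (E_Q L - m).
   Upper bound: take Qh = W and Q = W (1 - c (L - m)) with c of order sqrt r; the
   term D(Q||W) is O(r).  Lower bound: feasibility gives E_Qh L >= m, hence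
   E_Q L - m >= E_Q L - E_Qh L.  Either D(Q||W) already compensates for this, or
   Q, Qh are both close to W, and Cauchy-Schwarz bounds the right-hand side by
   sqrt (chi2(Q, Qh) Var_W L) up to a factor close to 1.  The case i = 1 follows
   by exchanging P0 and P1. *)
Require Import Defs.
From HB Require Import structures.
From mathcomp Require Import all_boot all_order all_algebra.
From mathcomp Require Import all_classical all_reals all_analysis.
From mathcomp Require Import ring lra.
Import Order.TTheory GRing.Theory Num.Theory.
Import numFieldNormedType.Exports.
Local Open Scope classical_set_scope.
Local Open Scope ring_scope.

(** * Calculus *)

(** The difference quotient is multiplied out, so that the estimate also covers t = x. *)
Lemma is_derive_dist_le (R : realType) (f : R -> R) (x l eps : R) :
  is_derive x 1 f l -> 0 < eps ->
  exists2 delta, 0 < delta &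
    forall t, `|t - x| < delta -> `|f t - f x - l * (t - x)| <= eps * `|t - x|.
Proof.
move=> [df dl] e0.
have dfl : h^-1 *: (f (h *: 1 + x) - f x) @[h --> 0^'] --> l by rewrite -dl; exact: df.
move/cvgrPdist_le: dfl => /(_ _ e0) [delta /= d0 H].
exists delta => // t td; have [->|tx] := eqVneq t x.
  by rewrite !subrr mulr0 subr0 normr0 mulr0.
have tx0 : t - x != 0 by rewrite subr_eq0.
have /= := H (t - x); rewrite sub0r normrN => /(_ td tx0).
rewrite [X in f X](_ : _ = t); last by rewrite /GRing.scale /= mulr1 subrK.
rewrite /GRing.scale /= => le.
have -> : f t - f x - l * (t - x) = - ((l - (t - x)^-1 * (f t - f x)) * (t - x)).
  by field.
by rewrite normrN normrM ler_wpM2r.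
Qed.

(** Convexity bounds f (x + t (y - x)) by f x + t (f y - f x). Comparison with the first-order
    expansion at x for one small t, and division by t, leaves an arbitrarily small error e. *)
Lemma convex_ge_tangent (R : realType) (f : R -> R) (x y : R) :
  (forall x y t, 0 < x -> 0 < y -> 0 <= t <= 1 ->
     f (t * x + (1 - t) * y) <= t * f x + (1 - t) * f y) ->
  0 < x -> 0 < y -> derivable f x 1 ->
  f x + derive1 f x * (y - x) <= f y.
Proof.
move=> cvxf x0 y0 dfx; rewrite derive1E; set l := 'D_1 f x.
have dfl : is_derive x 1 f l by exact: derivableP.
have [->|yx] := eqVneq y x; first by rewrite subrr mulr0 addr0.
have yx0 : 0 < `|y - x| by rewrite normr_gt0 subr_eq0.
apply/ler_addgt0Pr => e e0.
have [delta d0 H] := is_derive_dist_le _ f x l (e / `|y - x|) dfl (divr_gt0 e0 yx0).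
pose t := Num.min (1 / 2) (delta / (2 * `|y - x|)).
have t0 : 0 < t by rewrite lt_min !divr_gt0 // mulr_gt0.
have t1 : t <= 1 / 2 by rewrite ge_min lexx.
have td : t * `|y - x| <= delta / 2.
  rewrite -ler_pdivlMr// -mulrA -invfM; by rewrite ge_min lexx orbT.
have t01 : 0 <= t <= 1 by rewrite ltW //=; lra.
have := H (t * y + (1 - t) * x).
have -> : t * y + (1 - t) * x - x = t * (y - x) by ring.
rewrite normrM (gtr0_norm t0) => /(_ _)/wrap[]; first lra.
have -> : e / `|y - x| * (t * `|y - x|) = t * e by field; rewrite gt_eqF.
rewrite ler_norml => /andP[H1 _].
have := cvxf y x t y0 x0 t01 => H2.
have : t * (f x + l * (y - x)) <= t * (f y + e) by nra.
by rewrite ler_pM2l.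
Qed.

(** Only differentiability of [g'] at 1 is assumed, so the mean value theorem is applied to [h], the
    difference between g and its quadratic model, whose derivative is o(|t - 1|). *)
Lemma second_order_expansion (R : realType) (g g' : R -> R) (alpha eps : R) :
  g 1 = 0 -> g' 1 = 0 -> (forall x : R, 0 < x -> is_derive x 1 g (g' x)) ->
  is_derive (1 : R) 1 g' alpha -> 0 < eps ->
  exists2 rho, 0 < rho & forall t, `|t - 1| < rho ->
    `|g t - alpha / 2 * (t - 1) ^+ 2| <= eps * (t - 1) ^+ 2.
Proof.
move=> g1 g'1 dg dg' e0.
have [delta d0 H] := is_derive_dist_le _ g' 1 alpha eps dg' e0.
exists (Num.min delta 1); first by rewrite lt_min d0 ltr01.
move=> t; rewrite lt_min => /andP[td t1].
pose h (s : R) := g s - alpha / 2 * (s - 1) ^+ 2.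
pose h' (s : R) := g' s - alpha * (s - 1).
have dh (s : R) : 0 < s -> is_derive s 1 h (h' s).
  move=> s0; have dgs := dg _ s0; apply: is_derive_eq.
  by rewrite /h' /GRing.scale /=; field.
have h1 : h 1 = 0 by rewrite /h g1 subrr expr0n /= mulr0 subrr.
have t0 : 0 < t by move: t1; rewrite ltr_norml; lra.
have contdh a b : 0 < a -> {within `[a, b], continuous h}.
  move=> a0; apply: derivable_within_continuous => s; rewrite in_itv /= => /andP[as_ _].
  by have [] := dh s (lt_le_trans a0 as_).
have bd s : `|s - 1| <= `|t - 1| -> `|h' s| <= eps * `|t - 1|.
  move=> st; rewrite /h'; have := H s (le_lt_trans st td); rewrite g'1 subr0 => Hs.
  by rewrite (le_trans Hs) // ler_wpM2l // ltW.
have [c cb hc] : exists2 c, `|c - 1| <= `|t - 1| & h t - h 1 = h' c * (t - 1).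
  have [lt|lt|->] := ltgtP t 1; last by exists 1; rewrite // !subrr mulr0.
    have [|c] := @MVT _ h h' t 1 lt _ (contdh t 1 t0).
      by move=> s; rewrite in_itv /= => /andP[? _]; apply: dh; lra.
    rewrite in_itv /= => /andP[tc c1] E; exists c; last by lra.
    by rewrite !ltr0_norm; lra.
  have [|c] := @MVT _ h h' 1 t lt _ (contdh 1 t ltr01).
    by move=> s; rewrite in_itv /= => /andP[? _]; apply: dh; lra.
  rewrite in_itv /= => /andP[tc c1] E; exists c; last by lra.
  by rewrite !gtr0_norm; lra.
rewrite -/(h t) -[h t]subr0 -h1 hc normrM -[X in _ <= _ * X]real_normK ?num_real //.
by rewrite expr2 mulrA ler_wpM2r // bd.
Qed.

(** Young's inequality for the product of u^p and 1, with conjugate exponents 1/p and 1/(1 - p). *)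
Lemma powR_bernoulli_lt1 (R : realType) (p u : R) : 0 < p -> p < 1 -> 0 <= u ->
  u `^ p <= 1 + p * (u - 1).
Proof.
move=> p0 p1 u0.
have q0 : 0 < 1 - p by lra.
have := @conjugate_powR R (u `^ p) 1 p^-1 (1 - p)^-1 (powR_ge0 _ _) ler01.
rewrite !invr_gt0 !invrK => /(_ p0 q0) /(_ _)/wrap[]; first ring.
rewrite -powRrM mulfV ?gt_eqF // powRr1 // powR1; lra.
Qed.

(** Division by p - 1 unites the concave and the convex power. For p > 1 the previous bound is
    applied to u^p with exponent 1/p. *)
Lemma powR_bernoulli (R : realType) (p u : R) : 0 < p -> p != 1 -> 0 <= u ->
  0 <= (u `^ p - 1 - p * (u - 1)) / (p - 1).
Proof.
move=> p0 p1 u0; have [lt|gt|e] := ltgtP p 1; last by rewrite e eqxx in p1.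
  have := powR_bernoulli_lt1 _ _ _ p0 lt u0.
  by move=> ?; apply: mulr_le0; rewrite ?invr_le0; lra.
have pV1 : p^-1 < 1 by rewrite invf_lt1.
have := powR_bernoulli_lt1 _ p^-1 (u `^ p) _ pV1 (powR_ge0 _ _).
rewrite invr_gt0 -powRrM mulfV ?gt_eqF // powRr1 // => /(_ p0) H.
apply: divr_ge0; last lra.
have := ler_wpM2l (ltW p0) H; rewrite mulrDr mulrA mulfV ?gt_eqF //; lra.
Qed.

(** * Divergences *)

(* The tangent lower bound of the f-divergence of g: it stays finite when Qh
   vanishes somewhere, and equals sum_a Qh g(Q/Qh) at x = Q/Qh. *)
Definition tangent_sum {R : realType} {X : finType} (g g' : R -> R) (Q Qh x : X -> R) : R :=
  \sum_a (Qh a * g (x a) + g' (x a) * (Q a - x a * Qh a)).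

(* [g] is f - f'(1)(t - 1), with derivative [g']; [c] translates the radius, since
   a ball of the Renyi divergence of radius r is a ball of radius c r for the
   f-divergence of (t^alpha - 1)/(alpha - 1). *)
Definition divergence_like {R : realType} {X : finType}
    (d : (X -> R) -> (X -> R) -> \bar R) (alpha : R) : Prop :=
  exists g g' c : R -> R,
    [/\ [/\ g 1 = 0, g' 1 = 0, forall x : R, 0 < x -> is_derive x 1 g (g' x)
          & is_derive (1 : R) 1 g' alpha],
        forall x : R, 0 < x -> 0 <= g x,
        c 0 = 0 /\ is_derive (0 : R) 1 c 1,
        forall (Q Qh x : X -> R) (r : R), is_pmf Q -> is_pmf Qh -> (forall a, 0 < x a) -> 0 < r ->
          (d Q Qh <= r%:E)%E -> tangent_sum g g' Q Qh x <= c r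
      & forall (Q Qh : X -> R) (r : R), is_pmf Q -> is_pmf Qh -> full_support Q -> full_support Qh ->
          0 < r -> \sum_a Qh a * g (Q a / Qh a) <= c r -> (d Q Qh <= r%:E)%E].

(** * f-divergences *)

(** [f_at0] is a supremum of chords through t and 1 extrapolated to 0. The chord for one small t
    already reaches A - e. *)
Lemma f_at0_ge (R : realType) (f : R -> R) (A B : R) : f 1 = 0 ->
  (forall t, 0 < t -> A + B * t <= f t) -> (A%:E <= f_at0 f)%E.
Proof.
move=> f1 lef; apply/lee_addgt0Pr => e e0; rewrite -leeBlDr //.
pose t := Num.min (1 / 2) (e / (2 * (`|A + B| + 1))).
have n0 : 0 < `|A + B| + 1 by rewrite ltr_wpDl.
have t0 : 0 < t by rewrite lt_min !divr_gt0 // mulr_gt0.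
have t1 : t <= 1 / 2 by rewrite ge_min lexx.
have te : t * (`|A + B| + 1) <= e / 2.
  by rewrite -ler_pdivlMr// -mulrA -invfM ge_min lexx orbT.
apply: (@le_trans _ _ (f 1 - (f 1 - f t) / (1 - t))%:E); last first.
  by apply: ereal_sup_ubound; exists t => //=; rewrite in_itv /= t0; lra.
rewrite -EFinB lee_fin f1 !sub0r mulNr opprK ler_pdivlMr; last lra.
have := lef t t0; have := ler_norm (- (A + B)); rewrite normrN; nra.
Qed.

(** The chord slope from 1 to t is at least B + (A + B) / (t - 1), and a large t makes the last term
    at least -e. *)
Lemma f_atinf_ge (R : realType) (f : R -> R) (A B : R) : f 1 = 0 ->
  (forall t, 0 < t -> A + B * t <= f t) -> (B%:E <= f_atinf f)%E.
Proof.
move=> f1 lef; apply/lee_addgt0Pr => e e0; rewrite -leeBlDr //.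
pose t := 1 + (`|A + B| + 1) / e.
have n0 : 0 < `|A + B| + 1 by rewrite ltr_wpDl.
have t1 : 1 < t by rewrite ltrDl divr_gt0.
have te : e * (t - 1) = `|A + B| + 1 by rewrite /t; field; rewrite gt_eqF.
apply: (@le_trans _ _ ((f t - f 1) / (t - 1))%:E); last first.
  by apply: ereal_sup_ubound; exists t => //=; rewrite in_itv /= t1.
rewrite -EFinB lee_fin f1 subr0 ler_pdivlMr; last lra.
have := lef t (lt_trans ltr01 t1); have := ler_norm (- (A + B)); rewrite normrN; nra.
Qed.

(** Subtracting l (t - 1) does not change the sum of Qh f(Q/Qh), because Q and Qh have the same
    mass. The tangent bound holds term by term, including the conventions for Q a = 0 and Qh a =
    0. *)
Lemma f_div_like (R : realType) (X : finType) (f : R -> R) :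
  (forall x y t, 0 < x -> 0 < y -> 0 <= t <= 1 ->
     f (t * x + (1 - t) * y) <= t * f x + (1 - t) * f y) ->
  (forall x, 0 < x -> derivable f x 1) -> derivable (derive1 f) 1 1 -> f 1 = 0 ->
  divergence_like (@f_div R X f) (derive1 (derive1 f) 1).
Proof.
move=> cvxf df ddf f1; pose l := derive1 f 1.
have tangent x y : 0 < x -> 0 < y -> f x + derive1 f x * (y - x) <= f y.
  by move=> x0 y0; apply: convex_ge_tangent => //; exact: df.
exists (fun t => f t - l * (t - 1)), (fun t => derive1 f t - l), id; split.
- split.
  + by rewrite f1 subrr mulr0 subrr.
  + by rewrite subrr.
  + move=> x x0; have dfx : is_derive x 1 f (derive1 f x).
      by rewrite derive1E; apply: derivableP; exact: df.
    by apply: is_derive_eq; rewrite /GRing.scale /=; ring.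
  + have d2 : is_derive (1 : R) 1 (derive1 f) (derive1 (derive1 f) 1).
      by rewrite [derive1 (derive1 f) 1]derive1E; exact: derivableP.
    by apply: is_derive_eq; rewrite subr0.
- by move=> x x0; have := tangent 1 x ltr01 x0; rewrite f1 -/l; lra.
- by split => //; exact: is_derive_id.
- move=> Q Qh x r [Q0 Q1] [Qh0 Qh1] x0 r0 dr; rewrite -lee_fin; apply: le_trans dr.
  have -> : tangent_sum (fun t => f t - l * (t - 1)) (fun t => derive1 f t - l) Q Qh x =
      \sum_a (Qh a * f (x a) + derive1 f (x a) * (Q a - x a * Qh a)).
    apply/eqP; rewrite -subr_eq0 -sumrB; apply/eqP.
    transitivity (\sum_a (l * (Qh a - Q a))); first by apply: eq_bigr => a _; ring.
    by rewrite -mulr_sumr sumrB Qh1 Q1 subrr mulr0.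
  rewrite -sumEFin; apply: lee_sum => a _.
  (* The tangent at [x a] as intercept plus slope: the intercept bounds [f_at0], the slope bounds
     [f_atinf]. *)
  have tx t : 0 < t -> f (x a) - x a * derive1 f (x a) + derive1 f (x a) * t <= f t.
    by move=> t0; apply: le_trans (tangent (x a) t (x0 a) t0); lra.
  case: ifPn => [h0|]; last rewrite -leNgt => h0; (case: ifPn => [q0|]; last rewrite -leNgt => q0).
  + rewrite lee_fin.
    have := ler_wpM2l (ltW h0) (tx (Q a / Qh a) (divr_gt0 q0 h0)).
    apply: le_trans; rewrite le_eqVlt; apply/orP; left; apply/eqP; field; exact: lt0r_neq0.
  + have -> : Q a = 0 by apply/le_anti; rewrite q0 Q0.
    have -> : Qh a * f (x a) + derive1 f (x a) * (0 - x a * Qh a) =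
      Qh a * (f (x a) - x a * derive1 f (x a)) by ring.
    by rewrite EFinM lee_pmul2l //; exact: f_at0_ge tx.
  + have -> : Qh a = 0 by apply/le_anti; rewrite h0 Qh0.
    rewrite mul0r add0r mulr0 subr0 mulrC EFinM lee_pmul2l //; exact: f_atinf_ge tx.
  + have -> : Q a = 0 by apply/le_anti; rewrite q0 Q0.
    have -> : Qh a = 0 by apply/le_anti; rewrite h0 Qh0.
    by rewrite mul0r add0r mulr0 subr0 mulr0.
- move=> Q Qh r [Q0 Q1] [Qh0 Qh1] Qp Qhp r0 le.
  rewrite /f_div; under eq_bigr do rewrite Qp Qhp.
  rewrite sumEFin lee_fin; apply: le_trans le; rewrite le_eqVlt; apply/orP; left; apply/eqP.
  apply/eqP; rewrite -subr_eq0 -sumrB; apply/eqP.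
  transitivity (\sum_a (l * (Q a - Qh a))).
    by apply: eq_bigr => a _; field; rewrite gt_eqF.
  by rewrite -mulr_sumr sumrB Qh1 Q1 subrr mulr0.
Qed.

(** * Rényi divergences *)

Lemma ln_le_subr1 (R : realType) (u : R) : 0 < u -> ln u <= u - 1.
Proof. by move=> u0; have := @le_ln1Dx R (u - 1); rewrite subrKC; apply; lra. Qed.

(** g is t ln t minus its tangent at 1; the extra terms - Q + Qh sum to zero. *)
Lemma renyi1_like (R : realType) (X : finType) : divergence_like (@renyi_div R X 1) 1.
Proof.
exists (fun t => t * ln t - t + 1), (@ln R), id; split.
- split.
  + by rewrite ln1; ring.
  + exact: ln1.
  + move=> x x0; have dl := is_derive1_ln x0.
    by apply: is_derive_eq; rewrite /GRing.scale /=; field; rewrite gt_eqF.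
  + by have := is_derive1_ln (@ltr01 R); rewrite invr1.
- move=> x x0; have := ln_le_subr1 _ x^-1; rewrite invr_gt0 lnV // => /(_ x0) H.
  by have := ler_wpM2l (ltW x0) H; rewrite mulrBr mulfV ?gt_eqF //; lra.
- by split => //; exact: is_derive_id.
- move=> Q Qh x r [Q0 Q1] [Qh0 Qh1] x0 r0; rewrite /renyi_div eqxx.
  case: asboolP => [_|H]; first by rewrite leye_eq.
  rewrite lee_fin; apply: le_trans; rewrite /tangent_sum.
  have -> : \sum_a Q a * ln (Q a / Qh a) = \sum_a (Q a * ln (Q a / Qh a) - Q a + Qh a).
    by rewrite big_split /= sumrB Q1 Qh1 subrK.
  apply: ler_sum => a _; have [q0|] := ltP 0 (Q a).
    have h0 : 0 < Qh a.
      by rewrite lt0r Qh0 andbT; apply/eqP => h0; apply: H; exists a.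
    have xh0 : 0 < x a * Qh a by rewrite mulr_gt0.
    (* After expansion, the termwise claim is ln u <= u - 1 at u = x Qh / Q, multiplied by Q. *)
    have := ln_le_subr1 _ (x a * Qh a / Q a) (divr_gt0 xh0 q0).
    rewrite !ln_div ?lnM ?posrE // => /(ler_wpM2l (ltW q0)).
    rewrite [X in _ <= X]mulrBr mulrCA mulfV ?gt_eqF //; lra.
  move=> q0; have -> : Q a = 0 by apply/le_anti; rewrite q0 Q0.
  have := mulr_ge0 (ltW (x0 a)) (Qh0 a); lra.
- move=> Q Qh r [Q0 Q1] [Qh0 Qh1] Qp Qhp r0; rewrite /renyi_div eqxx.
  case: asboolP => [[a [_ h0]]|_]; first by have := Qhp a; rewrite h0 ltxx.
  rewrite lee_fin; apply: le_trans; rewrite le_eqVlt; apply/orP; left; apply/eqP.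
  transitivity (\sum_a (Q a * ln (Q a / Qh a) - Q a + Qh a)).
    by rewrite big_split /= sumrB Q1 Qh1 subrK.
  by apply: eq_bigr => a _; field; rewrite gt_eqF.
Qed.

(** Turns a bound on the logarithm into one on the power sum s. Dividing both sides by p keeps the
    direction of the inequality for either sign of p. *)
Lemma le_lnV_expR (R : realType) (p s r : R) : p != 0 -> 0 < s ->
  (p^-1 * ln s <= r) = ((s - 1) / p <= (expR (p * r) - 1) / p).
Proof.
move=> p0 s0; have -> : p^-1 * ln s = ln s / p by rewrite mulrC.
have E : (ln s <= p * r) = (s <= expR (p * r)) by rewrite -ler_expR lnK.
have E' : (p * r <= ln s) = (expR (p * r) <= s) by rewrite -ler_expR lnK.
have [plt|pgt|p00] := ltgtP p 0; last by rewrite p00 eqxx in p0.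
  by rewrite ler_ndivrMr // (mulrC r) E' ler_nM2r ?invr_lt0 // lerD2r.
by rewrite ler_pdivrMr // (mulrC r) E ler_pM2r ?invr_gt0 // lerD2r.
Qed.

(** For h > 0 and u = q / (x h), the right side minus the left side is h x^alpha times the quotient
    of [powR_bernoulli] at u. *)
Lemma renyi_term_ge (R : realType) (alpha q h x : R) :
  0 < alpha -> alpha != 1 -> 0 <= q -> 0 <= h -> (1 < alpha -> h = 0 -> q = 0) -> 0 < x ->
  h * ((x `^ alpha - 1 - alpha * (x - 1)) / (alpha - 1)) +
     alpha * (x `^ (alpha - 1) - 1) / (alpha - 1) * (q - x * h) <=
  (q `^ alpha * h `^ (1 - alpha) - h - alpha * (q - h)) / (alpha - 1).
Proof.
move=> a0 a1 q0 h0 qh x0.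
have b0 : alpha - 1 != 0 by rewrite subr_eq0.
have b0' : 1 - alpha != 0 by rewrite subr_eq0 eq_sym.
have xE : x `^ (alpha - 1) = x `^ alpha / x.
  by rewrite powRB ?powRr1 // ?ltW // (negbTE a1) implyFb.
have y0 : 0 < x `^ alpha by exact: powR_gt0.
have [hp|hle] := ltP 0 h; last first.
  have h00 : h = 0 by apply/le_anti; rewrite hle h0.
  (* [powR] sends base 0 to 0 for every nonzero exponent, even a negative one, so the power term
     vanishes. For alpha < 1 the remaining difference is nonnegative; for alpha > 1 the hypothesis
     gives q = 0. *)
  rewrite h00 powR0 // !mulr0 mul0r add0r !subr0 xE.
  have [alt|agt|ae] := ltgtP alpha 1; last by rewrite ae eqxx in a1.
    rewrite -subr_ge0.
    have -> : (0 - alpha * q) / (alpha - 1) -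
        alpha * (x `^ alpha / x - 1) / (alpha - 1) * q =
        alpha * q * (x `^ alpha / x) / (1 - alpha).
      by field; rewrite b0 b0' gt_eqF.
    apply: divr_ge0; last lra.
    by rewrite !mulr_ge0 ?invr_ge0 // ltW.
  by rewrite (qh agt h00) !mulr0 subrr mul0r.
pose u := q / (x * h).
have u0 : 0 <= u by rewrite divr_ge0 // mulr_ge0 // ltW.
have qE : q = u * x * h by rewrite /u; field; rewrite !gt_eqF.
clearbody u.
have hE : h `^ alpha * h `^ (1 - alpha) = h.
  by rewrite -powRD ?subrKC ?powRr1 // gt_eqF // implybT.
have qaE : q `^ alpha * h `^ (1 - alpha) = u `^ alpha * x `^ alpha * h.
  have x0w := ltW x0; by rewrite qE !powRM ?mulr_ge0 // -mulrA hE.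
rewrite qaE xE -subr_ge0.
have -> : (u `^ alpha * x `^ alpha * h - h - alpha * (q - h)) / (alpha - 1) -
    (h * ((x `^ alpha - 1 - alpha * (x - 1)) / (alpha - 1)) +
       alpha * (x `^ alpha / x - 1) / (alpha - 1) * (q - x * h)) =
    h * x `^ alpha * ((u `^ alpha - 1 - alpha * (u - 1)) / (alpha - 1)).
  by rewrite qE; field; rewrite b0 gt_eqF.
by apply: mulr_ge0; [rewrite mulr_ge0 // ltW|exact: powR_bernoulli].
Qed.

(** With s the sum inside the logarithm, (s - 1) / (alpha - 1) is an f-divergence and equals c
    applied to the Rényi divergence. Here g is its generator minus the tangent at 1. *)
Lemma renyi_like (R : realType) (X : finType) (alpha : R) : 0 < alpha -> alpha != 1 ->
  divergence_like (@renyi_div R X alpha) alpha.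
Proof.
move=> a0 a1; have b0 : alpha - 1 != 0 by rewrite subr_eq0.
have sE (Q Qh : X -> R) : is_pmf Q -> is_pmf Qh ->
    (\sum_a Q a `^ alpha * Qh a `^ (1 - alpha) - 1) / (alpha - 1) =
    \sum_a (Q a `^ alpha * Qh a `^ (1 - alpha) - Qh a - alpha * (Q a - Qh a)) / (alpha - 1).
  move=> [_ Q1] [_ Qh1].
  by rewrite -mulr_suml !sumrB -mulr_sumr sumrB Q1 Qh1 subrr mulr0 subr0.
exists (fun t => (t `^ alpha - 1 - alpha * (t - 1)) / (alpha - 1)),
  (fun t => alpha * (t `^ (alpha - 1) - 1) / (alpha - 1)),
  (fun r => (expR ((alpha - 1) * r) - 1) / (alpha - 1)); split.
- split.
  + by rewrite powR1 !subrr mulr0 subrr mul0r.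
  + by rewrite powR1 subrr mulr0 mul0r.
  + move=> x x0; have dp := is_derive1_powR alpha x0.
    by apply: is_derive_eq; rewrite /GRing.scale /=; field.
  + have dp := is_derive1_powR (alpha - 1) (@ltr01 R).
    by apply: is_derive_eq; rewrite powR1 /GRing.scale /=; field.
- by move=> x x0; apply: powR_bernoulli => //; exact: ltW.
- split; first by rewrite mulr0 expR0 subrr mul0r.
  by apply: is_derive_eq; rewrite /GRing.scale /= mulr0 expR0; field.
- move=> Q Qh x r pQ pQh x0 r0; have [Q0 Q1] := pQ; have [Qh0 Qh1] := pQh.
  rewrite /renyi_div (negbTE a1).
  case: ifPn => [_|ninf]; first by rewrite leye_eq.
  case: ifPn => [_|s0]; first by rewrite leye_eq.
  rewrite lee_fin le_lnV_expR //; last first.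
    by rewrite lt0r s0 sumr_ge0 // => a _; rewrite mulr_ge0 ?powR_ge0.
  apply: le_trans; rewrite sE // /tangent_sum; apply: ler_sum => a _.
  apply: renyi_term_ge => // agt h0; apply/eqP; apply: contraNT ninf => q0.
  rewrite agt /=; apply/asboolP; exists a; split => //.
  by rewrite lt0r q0 Q0.
- move=> Q Qh r pQ pQh Qp Qhp r0; rewrite /renyi_div (negbTE a1).
  case: asboolP => [[a [_ h0]]|_]; first by have := Qhp a; rewrite h0 ltxx.
  rewrite andbF; set s := \sum_(x : X) Q x `^ alpha * _.
  (* Positivity needs a point of X, which exists because an empty sum cannot be 1. *)
  have s0 : 0 < s.
    case: (pickP (fun _ : X => true)) => [a _|none]; last first.
      by have := pQ.2; rewrite (eq_bigl _ _ none) big_pred0_eq => /esym/eqP; rewrite oner_eq0.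
    have t0 b : 0 < Q b `^ alpha * Qh b `^ (1 - alpha) by rewrite mulr_gt0 ?powR_gt0.
    rewrite /s (bigD1 a) //=; apply: ltr_wpDr => //.
    apply: sumr_ge0 => b _; exact: ltW (t0 b).
  rewrite gt_eqF // lee_fin le_lnV_expR //.
  apply: le_trans; rewrite /s sE // le_eqVlt; apply/orP; left; apply/eqP.
  apply: eq_bigr => a _.
  have -> : Q a `^ alpha * Qh a `^ (1 - alpha) = Qh a * (Q a / Qh a) `^ alpha.
    rewrite powRM ?invr_ge0 ?ltW // -[(Qh a)^-1]powR_inv1 ?ltW // -powRrM mulN1r.
    rewrite mulrCA -{2}[Qh a]powRr1 ?ltW // -powRD //.
    by rewrite [Qh a == 0]gt_eqF // implybT.
  by field; rewrite b0 gt_eqF.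
Qed.

Lemma admissible_divergence_like (R : realType) (X : finType) (alpha : R)
    (d : (X -> R) -> (X -> R) -> \bar R) :
  admissible_distance d alpha -> 0 < alpha /\ divergence_like d alpha.
Proof.
move=> [[a0 ->]|[f [cvxf [df [ddf [f1 [-> [a0 ->]]]]]]]]; split => //.
  by have [->|a1] := eqVneq alpha 1; [exact: renyi1_like|exact: renyi_like].
by apply: f_div_like => //; exact: ddf.
Qed.

(** * Consequences of a small divergence *)

Definition chi2 {R : realType} {X : finType} (Q Qh : X -> R) : R :=
  \sum_a (Q a - Qh a) ^+ 2 / Qh a.

Lemma pmf_le1 (R : realType) (X : finType) (Q : X -> R) a : is_pmf Q -> Q a <= 1.
Proof. by move=> [Q0 <-]; rewrite (bigD1 a) //= lerDl sumr_ge0. Qed.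

(** The tangent bound is tested at 1 + rho or 1 - rho in a single point. The slope of g there has
    absolute value at least k, so a deviation above eta would force c r >= k eta / 2. Using tangents
    avoids any lower bound on Qh. *)
Lemma divergence_like_close (R : realType) (X : finType)
    (d : (X -> R) -> (X -> R) -> \bar R) (alpha eta : R) :
  0 < alpha -> divergence_like d alpha -> 0 < eta ->
  exists2 delta, 0 < delta & forall (Q Qh : X -> R) (r : R), is_pmf Q -> is_pmf Qh -> 0 < r < delta ->
    (d Q Qh <= r%:E)%E -> forall a, `|Q a - Qh a| <= eta.
Proof.
move=> a0 [g [g' [c [[g1 g'1 dg dg'] g0 [c0 dc] H _]]]] e0.
have [d1 d10 H1] := is_derive_dist_le _ g' 1 alpha (alpha / 2) dg' (divr_gt0 a0 (ltr0Sn _ 1)).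
have [d2 d20 H2] := is_derive_dist_le _ c 0 1 1 dc ltr01.
(* Half of eta pays for the shift rho Qh a <= rho; the other half is multiplied by the slope k. *)
pose rho := Num.min (Num.min (1 / 2) (d1 / 2)) (eta / 2).
have rho0 : 0 < rho by rewrite !lt_min !divr_gt0.
have rho1 : rho <= 1 / 2 by rewrite !ge_min lexx.
have rhod : rho <= d1 / 2 by rewrite !ge_min lexx !orbT.
have rhoe : rho <= eta / 2 by rewrite !ge_min lexx !orbT.
pose k := alpha / 2 * rho.
have k0 : 0 < k by rewrite mulr_gt0 // divr_gt0.
have gp : k <= g' (1 + rho).
  have := H1 (1 + rho); rewrite g'1 subr0 addrAC subrr add0r gtr0_norm // => /(_ _)/wrap[].
    lra.
  by rewrite ler_norml /k => /andP[? _]; lra.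
have gm : g' (1 - rho) <= - k.
  have := H1 (1 - rho); rewrite g'1 subr0 addrAC subrr add0r normrN gtr0_norm // => /(_ _)/wrap[].
    lra.
  by rewrite ler_norml /k => /andP[_ ?]; lra.
(* Below this radius, c r <= 2 r < k eta / 2. *)
exists (Num.min d2 (k * eta / 4)); first by rewrite lt_min d20 divr_gt0 // mulr_gt0.
move=> Q Qh r pQ pQh /andP[r0]; rewrite lt_min => /andP[rd2 rk] dr a.
have cr : c r <= 2 * r.
  have := H2 r; rewrite c0 !subr0 gtr0_norm // => /(_ rd2).
  by rewrite ler_norml => /andP[_]; lra.
(* the tangent points are 1 everywhere except at a *)
have single y : 0 < y -> Qh a * g y + g' y * (Q a - y * Qh a) <= c r.
  move=> y0; have := H Q Qh (fun b => if b == a then y else 1) r pQ pQh _ r0 dr.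
  rewrite /tangent_sum (bigD1 a) //= eqxx big1 ?addr0; first by apply => b; case: ifP.
  by move=> b ba; rewrite (negbTE ba) g1 g'1 mulr0 mul0r addr0.
have Qha := pmf_le1 _ _ _ a pQh; have Qh0 := pQh.1 a.
have rQ : rho * Qh a <= rho by rewrite ler_piMr // ltW.
rewrite leNgt; apply/negP; rewrite ltr_normr => /orP[lt|lt].
  have := single (1 + rho); have := g0 (1 + rho).
  have -> : 0 < 1 + rho by lra.
  move=> /(_ isT) /(mulr_ge0 Qh0) gr /(_ isT) le.
  have : k * (eta / 2) <= g' (1 + rho) * (Q a - (1 + rho) * Qh a).
    by apply: ler_pM; lra.
  lra.
have := single (1 - rho); have := g0 (1 - rho).
have -> : 0 < 1 - rho by lra.
move=> /(_ isT) /(mulr_ge0 Qh0) gr /(_ isT) le.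
have : k * (eta / 2) <= (- g' (1 - rho)) * (- (Q a - (1 - rho) * Qh a)).
  by apply: ler_pM; lra.
rewrite mulrNN; lra.
Qed.

(** With tangent points Q/Qh the linear terms cancel, and the second-order expansion of g applies
    term by term. The necessary condition serves the lower bound on the exponent, the sufficient one
    the upper bound. *)
Lemma divergence_like_chi2 (R : realType) (X : finType)
    (d : (X -> R) -> (X -> R) -> \bar R) (alpha eps : R) :
  divergence_like d alpha -> 0 < eps ->
  exists2 rho, 0 < rho & forall (Q Qh : X -> R) (r : R), is_pmf Q -> is_pmf Qh -> full_support Qh ->
    (forall a, `|Q a - Qh a| <= rho * Qh a) -> 0 < r < rho ->
    ((d Q Qh <= r%:E)%E -> (alpha / 2 - eps) * chi2 Q Qh <= (1 + eps) * r) /\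
    ((alpha / 2 + eps) * chi2 Q Qh <= (1 - eps) * r -> (d Q Qh <= r%:E)%E).
Proof.
move=> [g [g' [c [[g1 g'1 dg dg'] g0 [c0 dc] H H']]]] e0.
have [d1 d10 H1] := second_order_expansion _ g g' alpha eps g1 g'1 dg dg' e0.
have [d2 d20 H2] := is_derive_dist_le _ c 0 1 eps dc e0.
exists (Num.min (Num.min (1 / 2) (d1 / 2)) d2).
  by rewrite !lt_min d20 !divr_gt0.
move=> Q Qh r pQ pQh Qhp close /andP[r0]; rewrite lt_min => /andP[_ rd2].
have closeh a : `|Q a / Qh a - 1| <= Num.min (1 / 2) (d1 / 2).
  have -> : Q a / Qh a - 1 = (Q a - Qh a) / Qh a by field; rewrite gt_eqF.
  rewrite normrM normfV (gtr0_norm (Qhp a)) ler_pdivrMr // (le_trans (close a)) //.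
  by rewrite ler_pM2r // ge_min lexx.
have uh a : 0 < Q a / Qh a.
  have := closeh a; rewrite le_min ler_norml => /andP[/andP[? _] _]; lra.
have Qp : full_support Q by move=> a; have := uh a; rewrite pmulr_lgt0 ?invr_gt0.
have sq a : Qh a * (Q a / Qh a - 1) ^+ 2 = (Q a - Qh a) ^+ 2 / Qh a.
  by field; rewrite gt_eqF.
have bd a : `|g (Q a / Qh a) - alpha / 2 * (Q a / Qh a - 1) ^+ 2| <=
    eps * (Q a / Qh a - 1) ^+ 2.
  by apply: H1; have := closeh a; rewrite le_min => /andP[_]; lra.
have cr : (1 - eps) * r <= c r <= (1 + eps) * r.
  have := H2 r; rewrite c0 !subr0 gtr0_norm // => /(_ rd2).
  by rewrite ler_norml => /andP[? ?]; apply/andP; split; lra.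
case/andP: cr => crl cru; split => [dr|le].
  apply: le_trans cru; apply: (le_trans _ (H Q Qh (fun a => Q a / Qh a) r pQ pQh uh r0 dr)).
  rewrite /chi2 mulr_sumr; apply: ler_sum => a _.
  have -> : Q a - Q a / Qh a * Qh a = 0 by field; rewrite gt_eqF.
  rewrite mulr0 addr0 -sq mulrCA ler_pM2l //.
  by have := bd a; rewrite ler_norml => /andP[? _]; lra.
apply: H' => //; apply: le_trans crl; apply: le_trans le.
rewrite /chi2 mulr_sumr; apply: ler_sum => a _.
rewrite -sq mulrCA ler_pM2l //.
by have := bd a; rewrite ler_norml => /andP[_ ?]; lra.
Qed.

(** * Relative entropy and a weighted Cauchy-Schwarz inequality *)

Lemma KL_ge0 (R : realType) (X : finType) (Q W : X -> R) :
  is_pmf Q -> is_pmf W -> full_support W -> 0 <= KL Q W.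
Proof.
move=> [Q0 Q1] [_ W1] Wp; rewrite -[leLHS](subrr 1) -{1}Q1 -W1 -sumrB.
apply: ler_sum => a _; have [q0|q0] := ltP 0 (Q a); last first.
  have -> : Q a = 0 by apply/le_anti; rewrite q0 Q0.
  by have := Wp a; lra.
have := ln_le_subr1 _ (W a / Q a) (divr_gt0 (Wp a) q0).
rewrite !ln_div ?posrE // => /(ler_wpM2l (ltW q0)).
rewrite [X in _ <= X]mulrBr mulrCA mulfV ?gt_eqF //; lra.
Qed.

(** ln u <= u - 1 at u = Q / W bounds each term by (Q - W)^2 / W + (Q - W), whose linear part sums
    to zero. *)
Lemma KL_le_chi2 (R : realType) (X : finType) (Q W : X -> R) :
  is_pmf Q -> is_pmf W -> full_support W -> KL Q W <= chi2 Q W.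
Proof.
move=> [Q0 Q1] [_ W1] Wp.
have -> : chi2 Q W = \sum_a ((Q a - W a) ^+ 2 / W a + (Q a - W a)).
  by rewrite big_split /= sumrB Q1 W1 subrr addr0.
apply: ler_sum => a _; have [q0|q0] := ltP 0 (Q a); last first.
  have -> : Q a = 0 by apply/le_anti; rewrite q0 Q0.
  rewrite mul0r sub0r sqrrN expr2 mulfK ?gt_eqF // subrr //.
have := ln_le_subr1 _ (Q a / W a) (divr_gt0 q0 (Wp a)) => /(ler_wpM2l (ltW q0)).
move/le_trans; apply; rewrite le_eqVlt; apply/orP; left; apply/eqP.
by field; rewrite gt_eqF.
Qed.

Lemma KL_change_reference (R : realType) (X : finType) (Q W P : X -> R) :
  is_pmf Q -> full_support W -> full_support P ->
  KL Q P = KL Q W + \sum_a Q a * ln (W a / P a).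
Proof.
move=> [Q0 _] Wp Pp; rewrite /KL -big_split /=; apply: eq_bigr => a _.
have [q0|q0] := ltP 0 (Q a); first by rewrite !ln_div ?posrE //; ring.
have -> : Q a = 0 by apply/le_anti; rewrite q0 Q0.
by rewrite !mul0r addr0.
Qed.

(** W lies in the exponential family through P with statistic L, so beyond [KL Q W] only the mean of
    L under Q matters. Both bounds on the exponent start from this identity. *)
Lemma KL_exponential_family (R : realType) (X : finType) (lam C : R) (Q P W L : X -> R) :
  is_pmf Q -> full_support W -> full_support P ->
  (forall a, ln (W a / P a) = lam * L a + C) ->
  KL Q P = KL Q W + lam * (\sum_a Q a * L a) + C.
Proof.
move=> pQ Wp Pp lnE; rewrite (KL_change_reference _ _ Q W P) // -addrA; congr (_ + _).
under eq_bigr do rewrite lnE mulrDr mulrCA.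
by rewrite big_split /= -mulr_sumr -mulr_suml pQ.2 mul1r.
Qed.

Lemma KL_self (R : realType) (X : finType) (W : X -> R) : full_support W -> KL W W = 0.
Proof. by move=> Wp; rewrite /KL big1 // => a _; rewrite divff ?gt_eqF // ln1 mulr0. Qed.

(** The quadratic polynomial in [quad] is nonnegative; for V > 0 it is evaluated at its minimiser T
    / V. *)
Lemma cauchy_schwarz_weighted (R : realType) (X : finType) (w u v : X -> R) :
  (forall a, 0 < w a) ->
  (\sum_a u a * v a) ^+ 2 <= (\sum_a u a ^+ 2 / w a) * (\sum_a w a * v a ^+ 2).
Proof.
move=> w0; set T := \sum_a u a * v a; set A := \sum_a _ / _; set V := \sum_a w a * _.
have quad t : 0 <= A - 2 * t * T + t ^+ 2 * V.
  rewrite /A /T /V !mulr_sumr -sumrB -big_split /=; apply: sumr_ge0 => a _.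
  have -> : u a ^+ 2 / w a - 2 * t * (u a * v a) + t ^+ 2 * (w a * v a ^+ 2) =
     w a * (u a / w a - t * v a) ^+ 2 by field; rewrite gt_eqF.
  by rewrite mulr_ge0 ?sqr_ge0 // ltW.
have V0 : 0 <= V by apply: sumr_ge0 => a _; rewrite mulr_ge0 ?sqr_ge0 // ltW.
have [Vp|V0'] := ltP 0 V.
  have := quad (T / V).
  have -> : A - 2 * (T / V) * T + (T / V) ^+ 2 * V = (A * V - T ^+ 2) / V.
    by field; rewrite gt_eqF.
  by rewrite pmulr_lge0 ?invr_gt0 // subr_ge0.
have VE : V = 0 by apply/le_anti; rewrite V0 V0'.
have [->|T0] := eqVneq T 0; first by rewrite expr0n VE mulr0.
(* For V = 0 the polynomial is affine in t, and this t gives the value -1. *)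
have := quad ((A + 1) / (2 * T)); rewrite VE.
have -> : A - 2 * ((A + 1) / (2 * T)) * T + ((A + 1) / (2 * T)) ^+ 2 * 0 = -1 by field.
by rewrite ler0N1.
Qed.

(** * Error exponents *)

(** The radius is written s^2, which makes the claim linear in s. The step away from W is shortened
    by the factor 1 - eta, to leave room for the error of the chi-square approximation. *)
Lemma exponent_upper (R : realType) (X : finType)
    (d : (X -> R) -> (X -> R) -> \bar R) (alpha lam C eps : R) (P W L : X -> R) :
  let m := \sum_a W a * L a in
  let V := \sum_a W a * (L a - m) ^+ 2 in
  let K := Num.sqrt (2 / alpha * V) in
  0 < alpha -> divergence_like d alpha -> 0 <= lam ->
  is_pmf W -> full_support W -> full_support P ->
  (forall a, ln (W a / P a) = lam * L a + C) -> 0 < eps ->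
  exists2 delta, 0 < delta & forall s, 0 < s < delta ->
    exists Q, [/\ is_pmf Q, (d Q W <= (s ^+ 2)%:E)%E &
      KL Q P <= KL W P - lam * K * s + eps * s].
Proof.
move=> m V K a0 dd lam0 pW Wp Pp lnE e0; have [W0 W1] := pW.
have ia0 : 0 <= alpha^-1 by rewrite invr_ge0 ltW.
have V0 : 0 <= V by apply: sumr_ge0 => a _; rewrite mulr_ge0 ?sqr_ge0.
have K0 : 0 <= K by exact: sqrtr_ge0.
have K2 : K ^+ 2 = 2 / alpha * V by rewrite sqr_sqrtr // mulr_ge0 // divr_ge0 // ltW.
have WL : \sum_a W a * (L a - m) = 0.
  under eq_bigr do rewrite mulrBr.
  by rewrite sumrB -mulr_suml W1 mul1r subrr.
have klE Q (pQ : is_pmf Q) := KL_exponential_family _ _ lam C Q P W L pQ Wp Pp lnE.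
have klWW := KL_self _ _ W Wp.
(* The shortening costs lam eta K s, at most eps s / 2. *)
pose eta := Num.min (1 / 2) (eps / (2 * (lam * K + 1))).
have n0 : 0 < lam * K + 1 by rewrite ltr_wpDl // mulr_ge0.
have eta0 : 0 < eta by rewrite lt_min !divr_gt0 // mulr_gt0.
have eta1 : eta <= 1 / 2 by rewrite ge_min lexx.
have etae : eta * (lam * K + 1) <= eps / 2.
  by rewrite -ler_pdivlMr// -mulrA -invfM ge_min lexx orbT.
(* With 2 eps' / alpha <= eta and eps' <= eta, feasibility reduces to (1 - eta)^2 (1 + eta) <= 1 -
   eta. *)
pose eps' := Num.min eta (alpha / 2 * eta).
have eps'0 : 0 < eps' by rewrite lt_min eta0 mulr_gt0 // divr_gt0.
have eps'1 : eps' <= eta by rewrite ge_min lexx.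
have eps'2 : eps' <= alpha / 2 * eta by rewrite ge_min lexx orbT.
have [rho rho0 H] := divergence_like_chi2 _ _ d alpha eps' dd eps'0.
(* For V nonzero this makes [chi2 Q W] equal to (1 - eta)^2 (2 / alpha) s^2. For V = 0 also K = 0,
   and Q is W itself. *)
pose kappa := (1 - eta) * K / V.
pose B := \sum_a `|L a - m|.
have kappa0 : 0 <= kappa by rewrite divr_ge0 // mulr_ge0 //; lra.
have B0 : 0 <= B by rewrite sumr_ge0.
have LB a : `|L a - m| <= B by rewrite /B (bigD1 a) //= lerDl sumr_ge0.
(* Keeps c |L - m| at most 1/2, so that Q is nonnegative, and at most rho. *)
pose tau := Num.min rho (1 / 2) / (kappa * B + 1).
have kB0 : 0 < kappa * B + 1 by rewrite ltr_wpDl // mulr_ge0.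
have tau0 : 0 < tau by rewrite divr_gt0 // lt_min rho0 divr_gt0.
(* The bound alpha eps / 4 makes the quadratic term [KL Q W] at most eps s / 2. *)
exists (Num.min (Num.min 1 rho) (Num.min tau (alpha * eps / 4))).
  by rewrite !lt_min rho0 tau0 ltr01 !divr_gt0 // mulr_gt0.
move=> s /andP[s0]; rewrite !lt_min => /andP[/andP[s1 srho] /andP[stau salpha]].
pose c := kappa * s; have c0 : 0 <= c by rewrite mulr_ge0 // ltW.
have cB : c * B <= Num.min rho (1 / 2).
  have : s * (kappa * B + 1) <= Num.min rho (1 / 2) by rewrite -ler_pdivlMr // ltW.
  by rewrite /c; lra.
have cLB a : `|c * (L a - m)| <= Num.min rho (1 / 2).
  by rewrite normrM ger0_norm //; apply: le_trans cB; rewrite ler_wpM2l.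
exists (fun a => W a * (1 - c * (L a - m))).
set Q := fun a => _.
have pQ : is_pmf Q.
  split=> [a|].
    have := cLB a; rewrite le_min => /andP[_]; rewrite ler_norml => /andP[? ?].
    by rewrite mulr_ge0 //; lra.
  rewrite -W1 /Q.
  under eq_bigr do rewrite mulrBr mulr1 mulrCA.
  by rewrite sumrB -mulr_sumr WL mulr0 subr0.
have chiE : chi2 Q W = c ^+ 2 * V.
  by rewrite /V mulr_sumr; apply: eq_bigr => a _; rewrite /Q; field; rewrite gt_eqF.
have QL : \sum_a Q a * L a = m - c * V.
  have : \sum_a Q a * L a - \sum_a W a * L a + c * V = 0.
    rewrite /V mulr_sumr -sumrB -big_split /=.
    transitivity (\sum_a (- (c * m)) * (W a * (L a - m))).
      by apply: eq_bigr => a _; rewrite /Q; ring.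
    by rewrite -mulr_sumr WL mulr0.
  rewrite -/m; lra.
have cV : c * V = (1 - eta) * K * s.
  rewrite /c /kappa; have [V00|V00] := eqVneq V 0; last by field.
  have -> : K = 0 by rewrite /K V00 mulr0 sqrtr0.
  by rewrite V00 !(mulr0, mul0r).
have c2V : c ^+ 2 * V = (1 - eta) ^+ 2 * (2 / alpha) * s ^+ 2 * (V != 0)%:R.
  have [V00|V00] := eqVneq V 0; first by rewrite V00 !mulr0.
  have -> : c ^+ 2 * V = (c * V) ^+ 2 / V by field.
  rewrite /= mulr1 cV !exprMn K2; field; rewrite V00 gt_eqF //.
have c2V' : c ^+ 2 * V <= (1 - eta) ^+ 2 * (2 / alpha) * s ^+ 2.
  rewrite c2V; apply: ler_piMr; last by rewrite lern1 leq_b1.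
  by apply: mulr_ge0; [apply: mulr_ge0; [exact: sqr_ge0|exact: mulr_ge0]|exact: sqr_ge0].
have s2 : 0 < s ^+ 2 < rho.
  rewrite exprn_gt0 //=; apply: le_lt_trans srho; rewrite expr2 ler_piMr // ltW //.
exists.
- exact: pQ.
- apply: (H Q W (s ^+ 2) pQ pW Wp _ s2).2 => [a|].
    have -> : Q a - W a = W a * - (c * (L a - m)) by rewrite /Q; ring.
    rewrite normrM normrN gtr0_norm // mulrC ler_pM2r //.
    by have := cLB a; rewrite le_min => /andP[].
  rewrite chiE; apply: le_trans (ler_wpM2l _ c2V') _; first by rewrite addr_ge0 ?divr_ge0 // ltW.
  have -> : (alpha / 2 + eps') * ((1 - eta) ^+ 2 * (2 / alpha) * s ^+ 2) =
     ((1 - eta) ^+ 2 * (1 + 2 / alpha * eps')) * s ^+ 2 by field; rewrite gt_eqF.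
  rewrite ler_wpM2r ?sqr_ge0 //.
  have : 2 / alpha * eps' <= eta.
    have -> : 2 / alpha * eps' = eps' / (alpha / 2) by field; rewrite gt_eqF.
    by rewrite ler_pdivrMr ?divr_gt0 // mulrC.
  nra.
rewrite !klE // klWW QL -/m cV.
have := KL_le_chi2 _ _ Q W pQ pW Wp; rewrite chiE => kl.
have kls : KL Q W <= eps / 2 * s.
  apply: le_trans kl _; apply: le_trans c2V' _.
  have : 2 / alpha * s <= eps / 2.
    have -> : 2 / alpha * s = s / (alpha / 2) by field; rewrite gt_eqF.
    by rewrite ler_pdivrMr ?divr_gt0 //; lra.
  move=> le; apply: (@le_trans _ _ (2 / alpha * s * s)); last by rewrite ler_wpM2r // ltW.
  have -> : 2 / alpha * s * s = 1 * (2 / alpha) * s ^+ 2 by ring.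
  rewrite ler_wpM2r ?sqr_ge0 // ler_wpM2r ?mulr_ge0 //.
  by rewrite expr_le1 //; lra.
have : lam * eta * K * s <= eps / 2 * s.
  rewrite ler_wpM2r ?(ltW s0) //; nra.
lra.
Qed.

(** Absorbs the losses of the lower bound, 1 + e from a change of weights and (1 + e) / (1 - e) from
    the chi-square estimate, into the factor (1 + 3 e)^2. *)
Lemma quadratic_correction (R : realType) (e s : R) : 0 < e -> e <= 1 / 2 -> 0 <= s ->
  (1 + e) * ((1 + e) * s) <= (1 - e) * ((1 + 3 * e) ^+ 2 * s).
Proof.
move=> e0 e1 s0.
have q0 : 0 <= 3 + 2 * e - 9 * e ^+ 2 by nra.
rewrite -subr_ge0.
have -> : (1 - e) * ((1 + 3 * e) ^+ 2 * s) - (1 + e) * ((1 + e) * s) =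
  e * (3 + 2 * e - 9 * e ^+ 2) * s by ring.
by rewrite !mulr_ge0 // ltW.
Qed.

Lemma exponent_lower (R : realType) (X : finType)
    (d : (X -> R) -> (X -> R) -> \bar R) (alpha lam C eps : R) (P W L : X -> R) :
  let m := \sum_a W a * L a in
  let V := \sum_a W a * (L a - m) ^+ 2 in
  let K := Num.sqrt (2 / alpha * V) in
  0 < alpha -> divergence_like d alpha -> 0 <= lam ->
  is_pmf W -> full_support W -> full_support P ->
  (forall a, ln (W a / P a) = lam * L a + C) -> 0 < eps ->
  exists2 delta, 0 < delta & forall s Q Qh, 0 < s < delta ->
    is_pmf Q -> is_pmf Qh -> m <= \sum_a Qh a * L a -> (d Q Qh <= (s ^+ 2)%:E)%E ->
      KL W P - lam * K * s - eps * s <= KL Q P.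
Proof.
move=> m V K a0 dd lam0 pW Wp Pp lnE e0; have [W0 W1] := pW.
have V0 : 0 <= V by apply: sumr_ge0 => a _; rewrite mulr_ge0 ?sqr_ge0.
have K0 : 0 <= K by exact: sqrtr_ge0.
have K2 : K ^+ 2 = 2 / alpha * V by rewrite sqr_sqrtr // mulr_ge0 // divr_ge0 // ltW.
have klE Q (pQ : is_pmf Q) := KL_exponential_family _ _ lam C Q P W L pQ Wp Pp lnE.
have klWW := KL_self _ _ W Wp.
(* The factor 1 + 3 e costs 3 e lam K s, at most eps s. *)
pose e := Num.min (1 / 2) (eps / (3 * (lam * K + 1))).
have n0 : 0 < lam * K + 1 by rewrite ltr_wpDl // mulr_ge0.
have e00 : 0 < e by rewrite lt_min !divr_gt0 // mulr_gt0.
have e1 : e <= 1 / 2 by rewrite ge_min lexx.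
have ee : e * (lam * K + 1) <= eps / 3.
  by rewrite -ler_pdivlMr// -mulrA -invfM ge_min lexx orbT.
pose eps' := Num.min e (alpha / 2 * e).
have eps'0 : 0 < eps' by rewrite lt_min e00 mulr_gt0 // divr_gt0.
have eps'1 : eps' <= e by rewrite ge_min lexx.
have eps'2 : eps' <= alpha / 2 * e by rewrite ge_min lexx orbT.
have [rho rho0 H] := divergence_like_chi2 _ _ d alpha eps' dd eps'0.
(* An explicit positive lower bound for W, without choosing a minimising point. *)
have [w0 w00 wW] : exists2 w0, 0 < w0 & forall a, w0 <= W a.
  exists (1 + \sum_a (W a)^-1)^-1.
    by rewrite invr_gt0 ltr_wpDr // sumr_ge0 // => a _; rewrite invr_ge0.
  move=> a; rewrite -[leRHS]invrK lef_pV2 ?posrE ?invr_gt0 //; last first.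
    by rewrite ltr_wpDr // sumr_ge0 // => b _; rewrite invr_ge0.
  rewrite (bigD1 a) //= addrCA lerDl addr_ge0 // sumr_ge0 // => b _; rewrite invr_ge0 //.
(* If Q is within eta1 of both W and Qh, then W / 2 <= Qh <= (1 + e) W and |Q - Qh| <= rho Qh. *)
pose eta1 := Num.min (e * w0 / 2) (rho * w0 / 2).
have eta10 : 0 < eta1 by rewrite lt_min !divr_gt0 // mulr_gt0.
have eta1e : eta1 <= e * w0 / 2 by rewrite ge_min lexx.
have eta1r : eta1 <= rho * w0 / 2 by rewrite ge_min lexx orbT.
(* Relative entropy is the Rényi divergence of order 1, so the same closeness lemma replaces
   Pinsker's inequality: a small [KL Q W] puts Q near W. *)
have [d1 d10 H1] := divergence_like_close _ _ _ 1 eta1 ltr01 (renyi1_like R X) eta10.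
pose B := lam * \sum_a `|L a|.
have B0 : 0 <= B by rewrite mulr_ge0 // sumr_ge0.
(* Makes the effect of replacing Qh by Q, at most eta2 B, no larger than the threshold d1 / 2 for
   [KL Q W]. *)
pose eta2 := Num.min eta1 (d1 / (2 * (B + 1))).
have B10 : 0 < B + 1 by rewrite ltr_wpDl.
have eta20 : 0 < eta2 by rewrite lt_min eta10 divr_gt0 // mulr_gt0.
have eta21 : eta2 <= eta1 by rewrite ge_min lexx.
have eta2B : eta2 * B <= d1 / 2.
  have : eta2 * (B + 1) <= d1 / 2.
    by rewrite -ler_pdivlMr// -mulrA -invfM ge_min lexx orbT.
  by lra.
have [d2 d20 H2] := divergence_like_close _ _ d alpha eta2 a0 dd eta20.
exists (Num.min 1 (Num.min rho d2)); first by rewrite !lt_min ltr01 rho0 d20.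
move=> s Q Qh /andP[s0]; rewrite !lt_min => /andP[s1 /andP[srho sd2]] pQ pQh mQh dr.
have s2s : s ^+ 2 <= s by rewrite expr2 ler_piMr // ltW.
have s20 : 0 < s ^+ 2 by rewrite exprn_gt0.
have close a : `|Q a - Qh a| <= eta2.
  by apply: (H2 Q Qh (s ^+ 2) pQ pQh _ dr); rewrite s20 (le_lt_trans s2s).
have QL : \sum_a (Q a - Qh a) * L a <= \sum_a Q a * L a - m.
  under eq_bigr do rewrite mulrBl.
  by rewrite sumrB lerD2l lerN2.
have QLl := ler_wpM2l lam0 QL.
rewrite !klE // klWW -/m.
have Ks0 : 0 <= lam * K * s by rewrite !mulr_ge0 // ltW.
have es0 : 0 <= eps * s by rewrite mulr_ge0 // ltW.
(* far from W, the term KL Q W absorbs the effect of the perturbation *)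
have [far|near] := leP (d1 / 2) (KL Q W).
  have : - (eta2 * B) <= lam * \sum_a (Q a - Qh a) * L a.
    rewrite /B mulrCA -mulrN ler_wpM2l // mulr_sumr -sumrN.
    apply: ler_sum => a _.
    have : `|(Q a - Qh a) * L a| <= eta2 * `|L a| by rewrite normrM ler_wpM2r.
    by rewrite ler_norml => /andP[].
  lra.
have kl0 := KL_ge0 _ _ Q W pQ pW Wp.
have QW a : `|Q a - W a| <= eta1.
  apply: (H1 Q W (d1 / 2) pQ pW); first by rewrite divr_gt0 //; lra.
  rewrite /renyi_div eqxx; case: asboolP => [[b [_ b0]]|_].
    by have := Wp b; rewrite b0 ltxx.
  by rewrite lee_fin ltW.
have Qhl a : W a / 2 <= Qh a.
  have ew : e * w0 <= w0 / 2 by rewrite mulrC ler_pM2l //; lra.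
  have := close a; have := QW a; rewrite !ler_norml => /andP[? ?] /andP[? ?].
  have := ler_wpM2l (ltW e00) (wW a); have := wW a; lra.
have Qhu a : Qh a <= (1 + e) * W a.
  have ew : e * w0 <= w0 / 2 by rewrite mulrC ler_pM2l //; lra.
  have := close a; have := QW a; rewrite !ler_norml => /andP[? ?] /andP[? ?].
  have := ler_wpM2l (ltW e00) (wW a); have := wW a; lra.
have Qhp : full_support Qh by move=> a; apply: lt_le_trans (Qhl a); rewrite divr_gt0.
have chi : (alpha / 2 - eps') * chi2 Q Qh <= (1 + eps') * s ^+ 2.
  apply: (H Q Qh (s ^+ 2) pQ pQh Qhp _ _).1 => // [a|].
    rewrite (le_trans (close a)) // (le_trans eta21) // (le_trans eta1r) //.
    by rewrite -mulrA ler_pM2l //; have := Qhl a; have := wW a; lra.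
  by rewrite s20 (le_lt_trans s2s).
have chi0 : 0 <= chi2 Q Qh.
  by apply: sumr_ge0 => a _; rewrite divr_ge0 ?sqr_ge0 // ltW.
pose T := \sum_a (Q a - Qh a) * (L a - m).
(* Q and Qh have equal mass, so L may be centred at m; Cauchy-Schwarz then produces the variance
   V. *)
have TE : \sum_a (Q a - Qh a) * L a = T.
  rewrite /T; under [RHS]eq_bigr do rewrite mulrBr.
  by rewrite sumrB -mulr_suml sumrB pQ.2 pQh.2 subrr mul0r subr0.
have T2 : T ^+ 2 <= ((1 + 3 * e) * K * s) ^+ 2.
  apply: le_trans (cauchy_schwarz_weighted _ _ W _ _ Wp) _; rewrite -/V.
  (* Passing from the weight W of Cauchy-Schwarz to the weight Qh of [chi2] costs the factor 1 +
     e. *)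
  have A : \sum_a (Q a - Qh a) ^+ 2 / W a <= (1 + e) * chi2 Q Qh.
    rewrite mulr_sumr; apply: ler_sum => a _.
    rewrite mulrCA; apply: ler_wpM2l; first exact: sqr_ge0.
    by rewrite ler_pdivlMr ?Qhp // mulrC ler_pdivrMr ?Wp.
  apply: le_trans (ler_wpM2r V0 A) _.
  rewrite !exprMn K2.
  have -> : (1 + 3 * e) ^+ 2 * (2 / alpha * V) * s ^+ 2 =
            (2 / alpha * (1 + 3 * e) ^+ 2 * s ^+ 2) * V by ring.
  rewrite ler_wpM2r //.
  have chi' : (1 - e) * (alpha / 2 * chi2 Q Qh) <= (1 + e) * s ^+ 2 by nra.
  have -> : (1 + e) * chi2 Q Qh = 2 / alpha * ((1 + e) * (alpha / 2 * chi2 Q Qh)).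
    by field; rewrite gt_eqF.
  have e10 : 0 < 1 - e by lra.
  rewrite -[leRHS]mulrA ler_pM2l ?divr_gt0 // -(ler_pM2l e10).
  rewrite mulrCA; apply: (@le_trans _ _ ((1 + e) * ((1 + e) * s ^+ 2))).
    by rewrite ler_wpM2l //; lra.
  exact: quadratic_correction e00 e1 (ltW s20).
have Ts : - ((1 + 3 * e) * K * s) <= T.
  rewrite lerNl; apply: le_trans (ler_norm _) _; rewrite normrN.
  rewrite -ler_sqr ?nnegrE ?normr_ge0 ?real_normK ?num_real //.
  by rewrite !mulr_ge0 ?(ltW s0) //; lra.
have : lam * (3 * e * K * s) <= eps * s.
  rewrite !mulrA ler_pM2r //; nra.
have := ler_wpM2l lam0 Ts; rewrite -TE; lra.
Qed.

(** * Tilted distributions and the exchange of P0 and P1 *)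

Lemma tilt_norm_gt0 (R : realType) (X : finType) (P0 P1 : X -> R) (lam : R) :
  is_pmf P0 -> full_support P0 -> full_support P1 ->
  0 < \sum_a (P0 a `^ (1 - lam)) * (P1 a `^ lam).
Proof.
move=> [_ P01] p0 p1; case: (pickP (fun _ : X => true)) => [a _|none]; last first.
  by move: P01; rewrite (eq_bigl _ _ none) big_pred0_eq => /esym/eqP; rewrite oner_eq0.
have t0 b : 0 < P0 b `^ (1 - lam) * P1 b `^ lam by rewrite mulr_gt0 ?powR_gt0.
by rewrite (bigD1 a) //=; apply: ltr_wpDr => //; apply: sumr_ge0 => b _; exact: ltW (t0 b).
Qed.

Lemma tilt_gt0 (R : realType) (X : finType) (P0 P1 : X -> R) (lam : R) :
  is_pmf P0 -> full_support P0 -> full_support P1 -> full_support (tilt P0 P1 lam).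
Proof.
move=> pP0 p0 p1 a; have Z0 := tilt_norm_gt0 _ _ _ _ lam pP0 p0 p1.
by rewrite divr_gt0 // mulr_gt0 // powR_gt0.
Qed.

Lemma tilt_pmf (R : realType) (X : finType) (P0 P1 : X -> R) (lam : R) :
  is_pmf P0 -> full_support P0 -> full_support P1 -> is_pmf (tilt P0 P1 lam).
Proof.
move=> pP0 p0 p1; split=> [a|]; first exact: ltW (tilt_gt0 _ _ _ _ lam pP0 p0 p1 a).
by rewrite -mulr_suml divff // gt_eqF // tilt_norm_gt0.
Qed.

(** Brings the tilted distribution into the form required by [KL_exponential_family], with statistic
    ln (P1 / P0). *)
Lemma ln_tilt_ratio (R : realType) (X : finType) (P0 P1 : X -> R) (lam : R) a :
  is_pmf P0 -> full_support P0 -> full_support P1 ->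
  ln (tilt P0 P1 lam a / P0 a) =
    lam * ln (P1 a / P0 a) - ln (\sum_a (P0 a `^ (1 - lam)) * (P1 a `^ lam)).
Proof.
move=> pP0 p0 p1; have Z0 := tilt_norm_gt0 _ _ _ _ lam pP0 p0 p1.
have n0 : 0 < P0 a `^ (1 - lam) * P1 a `^ lam by rewrite mulr_gt0 // powR_gt0.
rewrite ln_div ?posrE ?tilt_gt0 // /tilt ln_div ?posrE // lnM ?posrE ?powR_gt0 //.
by rewrite !ln_powR ln_div ?posrE //; ring.
Qed.

Lemma tilt_swap (R : realType) (X : finType) (P0 P1 : X -> R) (lam : R) :
  tilt P1 P0 (1 - lam) = tilt P0 P1 lam.
Proof.
apply/funext => a; rewrite /tilt subKr; congr (_ / _); first by rewrite mulrC.
by apply: eq_bigr => b _; rewrite mulrC.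
Qed.

Lemma Ehat_swap (R : realType) (X : finType) (d : (X -> R) -> (X -> R) -> \bar R)
    (P0 P1 : X -> R) (gamma r : R) :
  Ehat d P0 P1 gamma true r = Ehat d P1 P0 (- gamma) false r.
Proof.
rewrite /Ehat; congr (inf (image _ _)); apply/funext => Q; apply/propext => /=.
by split=> -[pQ [Qh [pQh [le dr]]]]; split => //; exists Qh; do 2!split => //; lra.
Qed.

(** The decision constraint is therefore linear in Q: it bounds the mean of the log-likelihood
    ratio. *)
Lemma KL_sub (R : realType) (X : finType) (Q P0 P1 : X -> R) :
  is_pmf Q -> full_support P0 -> full_support P1 ->
  KL Q P0 - KL Q P1 = \sum_a Q a * ln (P1 a / P0 a).
Proof. by move=> pQ p0 p1; rewrite (KL_change_reference _ _ Q P1 P0) // addrC addKr. Qed.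

(** Identifies theta as lam^2 (2 / alpha) V, whose square root is the slope lam K of the two
    bounds. *)
Lemma var_under_affine (R : realType) (X : finType) (W L : X -> R) (lam C : R) :
  is_pmf W ->
  var_under W (fun a => lam * L a + C) =
    lam ^+ 2 * \sum_a W a * (L a - \sum_b W b * L b) ^+ 2.
Proof.
move=> [_ W1]; rewrite /var_under; set m := \sum_b W b * L b.
have -> : \sum_a W a * (lam * L a + C) = lam * m + C.
  under eq_bigr do rewrite mulrDr mulrCA.
  by rewrite big_split /= -mulr_sumr -mulr_suml W1 mul1r.
have -> : \sum_a W a * (L a - m) ^+ 2 = \sum_a W a * L a ^+ 2 - m ^+ 2.
  transitivity (\sum_a (W a * L a ^+ 2 - (2 * m) * (W a * L a) + W a * m ^+ 2)).
    by apply: eq_bigr => a _; ring.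
  by rewrite big_split /= sumrB -mulr_sumr -mulr_suml W1 -/m; ring.
have -> : \sum_a W a * (lam * L a + C) ^+ 2 =
    lam ^+ 2 * (\sum_a W a * L a ^+ 2) + 2 * lam * C * m + C ^+ 2.
  transitivity (\sum_a (lam ^+ 2 * (W a * L a ^+ 2) + (2 * lam * C) * (W a * L a) +
      W a * C ^+ 2)).
    by apply: eq_bigr => a _; ring.
  by rewrite !big_split /= -!mulr_sumr -mulr_suml W1 mul1r -/m.
ring.
Qed.

(** * Expansion of the worst-case exponents *)

(** Both bounds are applied with s = sqrt r. Qh = W meets the constraint with equality, so the Q of
    [exponent_upper] is a feasible competitor. *)
Lemma Ehat_false_expansion (R : realType) (X : finType)
    (d : (X -> R) -> (X -> R) -> \bar R) (P0 P1 : X -> R) (lam alpha eps : R) :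
  let W := tilt P0 P1 lam in
  let theta := 2 / alpha * var_under W (fun x => ln (W x / P0 x)) in
  0 < alpha -> divergence_like d alpha -> 0 <= lam ->
  is_pmf P0 -> full_support P0 -> full_support P1 -> 0 < eps ->
  exists delta : R, 0 < delta /\ forall r : R, 0 < r < delta ->
    `| Ehat d P0 P1 (KL W P0 - KL W P1) false r - (KL W P0 - Num.sqrt (r * theta)) |
      <= eps * Num.sqrt r.
Proof.
move=> W theta a0 dd lam0 pP0 p0 p1 e0.
have pW : is_pmf W by exact: tilt_pmf.
have Wp : full_support W by exact: tilt_gt0.
pose L a := ln (P1 a / P0 a).
pose C := - ln (\sum_a (P0 a `^ (1 - lam)) * (P1 a `^ lam)).
have lnE a : ln (W a / P0 a) = lam * L a + C by exact: ln_tilt_ratio.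
set m := \sum_a W a * L a; set V := \sum_a W a * (L a - m) ^+ 2.
have V0 : 0 <= V by apply: sumr_ge0 => a _; rewrite mulr_ge0 ?sqr_ge0 // ltW.
have thetaE : theta = lam ^+ 2 * (2 / alpha * V).
  rewrite /theta; under [X in var_under _ X]eq_fun do rewrite lnE.
  by rewrite var_under_affine // -/m -/V mulrCA.
have [du du0 Hu] := exponent_upper _ _ d alpha lam C eps P0 W L a0 dd lam0 pW Wp p0 lnE e0.
have [dl dl0 Hl] := exponent_lower _ _ d alpha lam C eps P0 W L a0 dd lam0 pW Wp p0 lnE e0.
exists (Num.min du dl ^+ 2); split; first by rewrite exprn_gt0 // lt_min du0.
move=> r /andP[r0 rd].
have s0 : 0 < Num.sqrt r by rewrite sqrtr_gt0.
have s2 : Num.sqrt r ^+ 2 = r by rewrite sqr_sqrtr // ltW.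
have : Num.sqrt r < Num.min du dl.
  by rewrite -ltr_sqr ?nnegrE ?s2 ?(ltW s0) // le_min !ltW.
rewrite lt_min => /andP[su sl].
have -> : Num.sqrt (r * theta) = lam * Num.sqrt (2 / alpha * V) * Num.sqrt r.
  have lamV0 : 0 <= lam ^+ 2 * (2 / alpha * V).
    by apply: mulr_ge0; [exact: sqr_ge0|apply: mulr_ge0 => //; rewrite divr_ge0 // ltW].
  by rewrite thetaE mulrC sqrtrM // sqrtrM ?sqr_ge0 // sqrtr_sqr ger0_norm.
have [|Q [pQ dQ klQ]] := Hu (Num.sqrt r); first by rewrite s0.
rewrite s2 in dQ.
rewrite (KL_sub _ _ W P0 P1) // -/m; rewrite /Ehat; set S := (X in inf X).
(* A real infimum obeys the usual bounds only for a nonempty set bounded below; [SQ] and [Slb]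
   provide both properties as well as the two estimates. *)
have SQ : S (KL Q P0).
  by exists Q => //; split => //; exists W; rewrite KL_sub.
have Slb : lbound S (KL W P0 - lam * Num.sqrt (2 / alpha * V) * Num.sqrt r - eps * Num.sqrt r).
  move=> _ [Q' [pQ' [Qh [pQh [mQh dQ']]]] <-]; rewrite KL_sub // in mQh.
  by apply: (Hl (Num.sqrt r) Q' Qh) => //; rewrite ?s0 ?s2.
have lower := lb_le_inf (ex_intro _ _ SQ) Slb.
have upper := ge_inf (ex_intro _ _ Slb) SQ.
rewrite ler_norml; apply/andP; split; lra.
Qed.

Theorem theorem9 (R : realType) (X : finType) (P0 P1 : X -> R) (gamma lam alpha : R)
  (d : (X -> R) -> (X -> R) -> \bar R) :
  is_pmf P0 -> is_pmf P1 -> full_support P0 -> full_support P1 ->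
  - KL P0 P1 <= gamma <= KL P1 P0 ->
  0 <= lam <= 1 ->
  KL (tilt P0 P1 lam) P0 - KL (tilt P0 P1 lam) P1 = gamma ->
  admissible_distance d alpha ->
  forall i : bool,
    let Pi := if i then P1 else P0 in
    let Ei := KL (tilt P0 P1 lam) Pi in
    let thetai := 2 / alpha *
          var_under (tilt P0 P1 lam) (fun x => ln (tilt P0 P1 lam x / Pi x)) in
    forall eps : R, 0 < eps -> exists delta : R, 0 < delta /\
      forall r : R, 0 < r < delta ->
        `| Ehat d P0 P1 gamma i r - (Ei - Num.sqrt (r * thetai)) |
          <= eps * Num.sqrt r.
Proof.
move=> pP0 pP1 p0 p1 _ /andP[lam0 lam1] <- /admissible_divergence_like[a0 dd].
case=> Pi Ei thetai eps e0; last first.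
  exact: (Ehat_false_expansion _ _ d P0 P1 lam alpha eps a0 dd lam0 pP0 p0 p1 e0).
(* After the exchange of P0 and P1 the tilting parameter is 1 - lam, nonnegative since lam <= 1. *)
have lam0' : 0 <= 1 - lam by rewrite subr_ge0.
have := Ehat_false_expansion _ _ d P1 P0 (1 - lam) alpha eps a0 dd lam0' pP1 p1 p0 e0.
rewrite tilt_swap => -[delta [delta0 H]]; exists delta; split => // r /H.
by rewrite Ehat_swap (opprB (KL _ P0)).
Qed.
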